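(* Let $X$ be a nonempty finite or countably infinite set and let $\alpha=(\alpha_{xy})_{x,y\in X}$ be a matrix with nonnegative real entries. Assume that $w=(w_x)_{x\in X}$ is a vector with $w_x>0$ for all $x\in X$ and $\alpha w\le w$ (componentwise). Let $\Lambda\subseteq X$ and let $h_i\colon X\to[0,1]$ ($i\ge 1$) be functions with $0\le h_i\le\chi_\Lambda$ such that $$\sum_{i=1}^\infty h_i(x)=\infty\qquad\text{uniformly for }x\in\Lambda .$$ (i) If $\|(I_\Lambda\alpha I_\Lambda)^\ell\|_{w\to w}\to 0$ as $\ell\to\infty$, then $\|\beta_{h_1}\cdots\beta_{h_N}-\Pi_\Lambda\|_{w\to w}\to 0$ as $N\to\infty$. (ii) If the nonnegative vector $c\in l^1(w)$ is such that $\|c(I_\Lambda\alpha I_\Lambda)^\ell\|_w\to 0$ as $\ell\to\infty$, then $\|c(\beta_{h_1}\cdots\beta_{h_N}-\Pi_\Lambda)\|_w\to 0$ as $N\to\infty$.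
   Context: Vectors $c$ multiply matrices from the left (row vectors), $w$ from the right. $\chi_\Lambda$ is the indicator function of $\Lambda$ and $\Lambda^c=X\setminus\Lambda$. For $f\colon X\to\mathbb R$, $I_f$ is the diagonal matrix $(I_f)_{xy}=f(x)\delta_{xy}$, and $I_\Lambda=I_{\chi_\Lambda}$. For $f\colon X\to[0,1]$ the cleaning operator is $\beta_f=I_{1-f}+I_f\alpha$. The balayage operator is $\Pi_\Lambda=\sum_{k=0}^\infty(I_\Lambda\alpha)^kI_{\Lambda^c}$ (entrywise sum of nonnegative terms; under the hypothesis $\alpha w\le w$ with $w>0$ its entries are finite). For a vector $c$, $\|c\|_w=\sum_{x\in X}|c_x|w_x$, and $l^1(w)$ is the space of vectors with $\|c\|_w<\infty$. For a matrix $A$, $\|A\|_{w\to w}=\sup\{\|cA\|_w/\|c\|_w:\ c\ne 0\text{ of finite support}\}=\sup_{x\in X}w_x^{-1}\sum_{y\in X}|A_{xy}|w_y$. ''Uniformly'' means that for every $M<\infty$ there is $N$ with $\sum_{i=1}^N h_i(x)\ge M$ for all $x\in\Lambda$. *)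

(* Defs.v *)
From HB Require Import structures.
From mathcomp Require Import all_boot all_order all_algebra.
From mathcomp Require Import all_classical all_reals all_analysis.
Set Implicit Arguments.
Unset Strict Implicit.
Unset Printing Implicit Defensive.
Import Order.TTheory GRing.Theory Num.Theory.
Import numFieldNormedType.Exports.
Local Open Scope classical_set_scope.
Local Open Scope ring_scope.

Section Cleaning.
Context {R : realType} {X : countType}.
Implicit Types (c w f : X -> R) (A B alpha : X -> X -> R) (L : set X).

(* Meaningful only for absolutely summable families: [\esum] is the library's
   sum of nonnegative extended reals, and infinite sums are truncated by
   [fine]. Quantities allowed to be infinite, such as the norms below, are
   therefore kept in [\bar R]. *)
Definition usum f : R :=
  fine (esum [set: X] (EFin \o f)^\+%E - esum [set: X] (EFin \o f)^\-%E)%E.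

Definition vecmul c A : X -> R := fun y => usum (fun x => c x * A x y).

Definition matmul A B : X -> X -> R :=
  fun x y => usum (fun z => A x z * B z y).

Definition matadd A B : X -> X -> R := fun x y => A x y + B x y.

Definition matsub A B : X -> X -> R := fun x y => A x y - B x y.

Definition diagmat f : X -> X -> R := fun x y => f x *+ (x == y).

Definition setmat L : X -> X -> R := diagmat \1_L.

Definition matpow A (n : nat) : X -> X -> R :=
  iter n (fun B => matmul B A) (diagmat (fun=> 1)).

Definition wnorm w c : \bar R := (\esum_(x in [set: X]) (`|c x| * w x)%:E)%E.

Definition opnorm w A : \bar R :=
  ereal_sup [set (wnorm w (vecmul c A) / wnorm w c)%E | c in
    [set c : X -> R | finite_set [set x | c x != 0] /\ exists x, c x != 0]].

Definition subinvariant alpha w : Prop :=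
  forall x, (\esum_(y in [set: X]) (alpha x y * w y)%:E <= (w x)%:E)%E.

Definition cleaning alpha f : X -> X -> R :=
  matadd (diagmat (fun x => 1 - f x)) (matmul (diagmat f) alpha).

(* [cleaning_prod alpha h N] is beta_{h_1} ... beta_{h_N}; [h 0] is unused. *)
Fixpoint cleaning_prod alpha (h : nat -> X -> R) (N : nat) : X -> X -> R :=
  if N is n.+1 then matmul (cleaning_prod alpha h n) (cleaning alpha (h n.+1))
  else diagmat (fun=> 1).

(* [fine] loses nothing here when [alpha] is nonnegative and [subinvariant]
   for some positive [w], since the entries are then finite. *)
Definition balayage alpha L : X -> X -> R := fun x y =>
  fine (\sum_(0 <= k <oo)
    (matmul (matpow (matmul (setmat L) alpha) k) (setmat (~` L)) x y)%:E)%E.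

Definition restricted alpha L : X -> X -> R :=
  matmul (matmul (setmat L) alpha) (setmat L).

End Cleaning.

(* Main.v *)
Require Import Defs.
From HB Require Import structures.
From mathcomp Require Import all_boot all_order all_algebra.
From mathcomp Require Import all_classical all_reals all_analysis.
From mathcomp Require Import ring lra.
Import Order.TTheory GRing.Theory Num.Theory.
Import numFieldNormedType.Exports.
Local Open Scope classical_set_scope.
Local Open Scope ring_scope.

(** A matrix [A] with nonnegative entries and [A w <= w] acts on the functions
    [v] with [0 <= v <= K w] by convergent sums, and for [c >= 0] the norm of
    [c A] is the pairing of [c] with [A w]. Both claims thus become pointwise
    estimates of functions on [X]. Write [B_N] for the product of the first [N]
    cleaning operators, [Pi] for the balayage matrix, [I_L] for the projection
    to [L = Lambda], and [R = I_L alpha I_L].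

    Reduction to the mass left in [L]. The balayage matrix is the identity on
    the rows off [L] and satisfies [Pi = alpha Pi] on the rows in [L]. So every
    cleaning operator leaves it unchanged when multiplying it on the left
    ([act_cleaning_balayage]), and [B_N - Pi = B_N (I - Pi) = B_N I_L (I - Pi)].
    Since [Pi w <= w], the absolute value of [B_N - Pi] applied to [w] is at
    most [2 B_N I_L w] ([sub_balayage_le]).

    Decay of that mass. On a function vanishing off [L] the cleaning operator
    with parameter [f] is [v |-> (1 - f) v + f R v]. Let [R v <= v], and perform
    a block of steps whose parameters have sum [S] at [x]. The excess of the
    result over [R v] at [x] is at most [(v - R v) (x) / (1 + S)], because each
    step multiplies the excess by at most [1 - f (x)] ([sweep_excess]). Uniform
    divergence cuts the sequence of steps into consecutive blocks with [S] as
    large as desired on all of [L]; a block is then one application of [R] up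
    to a small multiple of [I_L w]. With [l] blocks, for all large [N],
    [B_N I_L w <= R^l I_L w + e I_L w] ([sweep_inner_le]).

    Conclusion. Given the tolerance, choose [l] first and then [N]: pairing with
    [c] gives (ii), dividing by [w (x)] uniformly in [x] gives (i). *)

(** * Sums of nonnegative families *)

(** One inequality is termwise on finite subfamilies; the other one is the same
    inequality for the inverse scalar. *)
Lemma esumZl {R : realType} {I : choiceType} (r : R) (a : I -> \bar R) :
  0 <= r -> (forall i, 0 <= a i)%E ->
  (\esum_(i in [set: I]) (r%:E * a i) = r%:E * \esum_(i in [set: I]) a i)%E.
Proof.
move=> r0 a0.
have le_scaled (s : R) (b : I -> \bar R) : 0 <= s -> (forall i, 0 <= b i)%E ->
    (\esum_(i in [set: I]) (s%:E * b i) <= s%:E * \esum_(i in [set: I]) b i)%E.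
  move=> s0 b0; rewrite ge_ereal_sup => //= _ [F [finF FI]] <-.
  rewrite -ge0_mule_fsumr//; apply: lee_wpmul2l; first by rewrite lee_fin.
  by apply: esum_ge; exists F.
apply/eqP; rewrite eq_le le_scaled//=.
have [->|r_neq0] := eqVneq r 0.
  by rewrite mul0e esum_ge0// => i _; rewrite mul0e.
have r_gt0 : 0 < r by rewrite lt_def r_neq0.
rewrite -lee_pdivlMl//.
apply: le_trans (le_scaled r^-1 _ _ _); last 2 first.
- by rewrite invr_ge0.
- by move=> i; rewrite mule_ge0// lee_fin.
by apply: le_esum => i _; rewrite muleA -EFinM mulVf// mul1e.
Qed.

Lemma esum_exchange {R : realType} {I J : choiceType} (a : I -> J -> \bar R) :
  (forall i j, 0 <= a i j)%E ->
  (\esum_(i in [set: I]) \esum_(j in [set: J]) a i j =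
   \esum_(j in [set: J]) \esum_(i in [set: I]) a i j)%E.
Proof.
move=> a0; rewrite !esum_esum//.
rewrite (reindex_esum ([set: J] `*`` (fun=> [set: I])) _ (fun x => (x.2, x.1)))//.
split=> //=; first by move=> [i1 i2] [j1 j2] /= _ _ [] -> ->.
by move=> [i1 i2] _ /=; exists (i2, i1).
Qed.

Lemma esum_single {R : realType} {I : choiceType} (i : I) (a : I -> \bar R) :
  (0 <= a i)%E -> (forall j, j != i -> a j = 0%E) ->
  \esum_(j in [set: I]) a j = a i.
Proof.
move=> a0 aj; rewrite -[RHS](@esum_set1 _ _ i)// [RHS]esum_mkcond.
apply: eq_esum => j _; case: ifPn => //; rewrite notin_setE/= => /eqP.
exact: aj.
Qed.

Section UnconditionalSums.
Set Implicit Arguments.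
Unset Strict Implicit.
Context {R : realType} {X : countType}.
Implicit Types f g : X -> R.

Lemma usumE f : (forall x, 0 <= f x) ->
  (\esum_(x in [set: X]) (f x)%:E < +oo)%E ->
  (usum f)%:E = (\esum_(x in [set: X]) (f x)%:E)%E.
Proof.
move=> f0 fin; rewrite /usum.
rewrite (eq_esum (b := fun x => (f x)%:E)); last first.
  by move=> x _; rewrite funeposE/= max_l// lee_fin.
rewrite [X in (_ - X)%E]esum1 ?sube0 ?fineK//; last first.
  by move=> x _; rewrite funenegE/= max_r// lee_fin oppr_le0.
by rewrite ge0_fin_numE// esum_ge0// => x _; rewrite lee_fin.
Qed.

Lemma usum_ge0 f : (forall x, 0 <= f x) -> 0 <= usum f.
Proof.
move=> f0; rewrite /usum [X in (_ - X)%E]esum1 ?sube0.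
  by rewrite fine_ge0// esum_ge0// => x _; exact: funepos_ge0.
by move=> x _; rewrite funenegE/= max_r// lee_fin oppr_le0.
Qed.

Lemma usum_single (i : X) f : 0 <= f i -> (forall j, j != i -> f j = 0) ->
  usum f = f i.
Proof.
move=> fi fj; have f0 j : 0 <= f j.
  by have [->//|/fj ->] := eqVneq j i.
have E : (\esum_(x in [set: X]) (f x)%:E)%E = (f i)%:E.
  by apply: esum_single; rewrite ?lee_fin// => j /fj ->.
by apply: EFin_inj; rewrite usumE ?E ?ltry.
Qed.

(** Also valid when the family is not summable, where [usum] is truncated: the
    bound is then infinite. *)
Lemma abs_usum_le f :
  (`|usum f|%:E <= \esum_(x in [set: X]) `|f x|%:E)%E.
Proof.
set S := (X in (_ <= X)%E).
have [Sfin|] := ltP S +oo%E; last by rewrite leye_eq => /eqP ->; rewrite leey.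
have le_part (g : X -> \bar R) :
    (forall x, 0 <= g x)%E -> (forall x, g x <= `|f x|%:E)%E ->
    exists2 r, 0 <= r & (\esum_(x in [set: X]) g x = r%:E /\ r%:E <= S)%E.
  move=> g0 gf; have gS : (\esum_(x in [set: X]) g x <= S)%E by exact: le_esum.
  have gp : (0 <= \esum_(x in [set: X]) g x)%E by exact: esum_ge0.
  exists (fine (\esum_(x in [set: X]) g x)%E); first exact: fine_ge0.
  by rewrite fineK// ge0_fin_numE// (le_lt_trans gS).
have [p p0 [pE pS]] : exists2 r, 0 <= r &
    (\esum_(x in [set: X]) (EFin \o f)^\+%E x = r%:E /\ r%:E <= S)%E.
  apply: le_part => x; first exact: funepos_ge0.
  by rewrite funeposE/= ge_max !lee_fin ler_norm normr_ge0.
have [n n0 [nE nS]] : exists2 r, 0 <= r &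
    (\esum_(x in [set: X]) (EFin \o f)^\-%E x = r%:E /\ r%:E <= S)%E.
  apply: le_part => x; first exact: funeneg_ge0.
  by rewrite funenegE/= ge_max !lee_fin -normrN ler_norm normr_ge0.
(* Both parts lie between [0] and [S], hence so does their distance. *)
rewrite /usum pE nE -EFinB/=.
have [pn|np] := leP n p.
  by apply: le_trans pS; rewrite lee_fin ger0_norm; lra.
by apply: le_trans nS; rewrite lee_fin ler0_norm; lra.
Qed.

End UnconditionalSums.

(** * Substochastic matrices acting on dominated functions *)

Definition act {R : realType} {X : countType} (A : X -> X -> R) (v : X -> R) :
  X -> R := fun x => usum (fun y => A x y * v y).

Section Action.
Set Implicit Arguments.
Unset Strict Implicit.
Context {R : realType} {X : countType}.
Variable w : X -> R.
Hypothesis w_gt0 : forall x, 0 < w x.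
Implicit Types (u v f : X -> R) (A B : X -> X -> R) (K : R) (x y : X).

Definition substochastic A := (forall x y, 0 <= A x y) /\ subinvariant A w.

(** On these functions the real-valued sums defining [act] are genuine sums, and
    the class is preserved with the same bound by substochastic matrices. *)
Definition dominated K v := forall x, 0 <= v x <= K * w x.

Lemma dominated_ge0 K v x : dominated K v -> 0 <= v x.
Proof. by move=> /(_ x)/andP[]. Qed.

Lemma dominated_bound_ge0 K v x : dominated K v -> 0 <= K.
Proof.
move=> /(_ x)/andP[v0 vK]; rewrite -(pmulr_lge0 _ (w_gt0 x)).
exact: le_trans vK.
Qed.

Lemma dominatedD K L u v : dominated K u -> dominated L v ->
  dominated (K + L) (fun x => u x + v x).
Proof.
move=> du dv x; move: (du x) (dv x) => /andP[? ?] /andP[? ?].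
by rewrite mulrDl addr_ge0// lerD.
Qed.

Lemma dominatedZ K r v : 0 <= r -> dominated K v ->
  dominated (r * K) (fun x => r * v x).
Proof.
move=> r0 dv x; move: (dv x) => /andP[? ?].
by rewrite mulr_ge0//= -mulrA ler_wpM2l.
Qed.

Lemma dominated_le K u v : (forall x, 0 <= u x <= v x) -> dominated K v ->
  dominated K u.
Proof.
move=> uv dv x; case/andP: (uv x) => -> /le_trans; apply.
by case/andP: (dv x).
Qed.

Lemma dominated_w : dominated 1 w.
Proof. by move=> x; rewrite ltW// mul1r lexx. Qed.

Lemma esum_act_le A K v x : substochastic A -> dominated K v ->
  (\esum_(y in [set: X]) (A x y * v y)%:E <= (K * w x)%:E)%E.
Proof.
move=> [A0 Aw] dv; have K0 := dominated_bound_ge0 x dv.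
apply: (@le_trans _ _ (K%:E * \esum_(y in [set: X]) (A x y * w y)%:E)%E).
  rewrite -esumZl//; last by move=> y; rewrite lee_fin mulr_ge0// ltW.
  apply: le_esum => y _; rewrite -EFinM lee_fin mulrCA ler_wpM2l//.
  by case/andP: (dv y).
by rewrite EFinM lee_wpmul2l// lee_fin.
Qed.

Lemma actE A K v x : substochastic A -> dominated K v ->
  (act A v x)%:E = (\esum_(y in [set: X]) (A x y * v y)%:E)%E.
Proof.
move=> sA dv; rewrite usumE//.
  by move=> y; rewrite mulr_ge0 ?(dominated_ge0 _ dv)//; case: sA.
by apply: le_lt_trans (esum_act_le x sA dv) _; rewrite ltry.
Qed.

Lemma act_dominated A K v : substochastic A -> dominated K v ->
  dominated K (act A v).
Proof.
move=> sA dv x; apply/andP; split.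
  by apply: usum_ge0 => y; rewrite mulr_ge0 ?(dominated_ge0 _ dv)//; case: sA.
by rewrite -lee_fin (actE _ sA dv) esum_act_le.
Qed.

Lemma act_le A K u v x : substochastic A -> (forall y, 0 <= u y <= v y) ->
  dominated K v -> act A u x <= act A v x.
Proof.
move=> sA uv dv; have du := dominated_le uv dv.
rewrite -lee_fin (actE _ sA du) (actE _ sA dv); apply: le_esum => y _.
by rewrite lee_fin ler_wpM2l//; [case: sA|case/andP: (uv y)].
Qed.

Lemma actD A K L u v x : substochastic A -> dominated K u -> dominated L v ->
  act A (fun y => u y + v y) x = act A u x + act A v x.
Proof.
move=> sA du dv; have A0 : forall x y, 0 <= A x y by case: sA.
apply: EFin_inj; rewrite EFinD (actE _ sA (dominatedD du dv)).
rewrite (actE _ sA du) (actE _ sA dv) -esumD.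
- by apply: eq_esum => y _; rewrite mulrDr EFinD.
- by move=> y _; rewrite lee_fin mulr_ge0// (dominated_ge0 _ du).
- by move=> y _; rewrite lee_fin mulr_ge0// (dominated_ge0 _ dv).
Qed.

Lemma actZ A K r v x : substochastic A -> 0 <= r -> dominated K v ->
  act A (fun y => r * v y) x = r * act A v x.
Proof.
move=> sA r0 dv; have A0 : forall x y, 0 <= A x y by case: sA.
apply: EFin_inj; rewrite EFinM (actE _ sA (dominatedZ r0 dv)) (actE _ sA dv).
rewrite -esumZl//; first by apply: eq_esum => y _; rewrite mulrCA.
by move=> y; rewrite lee_fin mulr_ge0// (dominated_ge0 _ dv).
Qed.

Lemma eq_act A u v x : u =1 v -> act A u x = act A v x.
Proof. by move=> /funext ->. Qed.

(** The weight at [y] times the entry [B x y] is one term of [(B w) x]. *)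
Lemma column_dominated B y : substochastic B ->
  dominated (w y)^-1 (fun x => B x y).
Proof.
move=> [B0 Bw] x; rewrite B0/= mulrC ler_pdivlMr// -lee_fin.
apply: le_trans (Bw x).
rewrite -(@esum_set1 _ _ y (fun z => (B x z * w z)%:E)); last first.
  by rewrite lee_fin mulr_ge0// ltW.
rewrite esum_mkcond; apply: le_esum => z _; case: ifPn => // _.
by rewrite lee_fin mulr_ge0// ltW.
Qed.

Lemma esum_act_matmul A B K v x :
  substochastic A -> substochastic B -> dominated K v ->
  (\esum_(y in [set: X]) (matmul A B x y * v y)%:E =
   \esum_(z in [set: X]) (A x z * act B v z)%:E)%E.
Proof.
move=> sA sB dv.
have A0 : forall x y, 0 <= A x y by case: sA.
have B0 : forall x y, 0 <= B x y by case: sB.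
have v0 y : 0 <= v y := dominated_ge0 y dv.
transitivity (\esum_(y in [set: X]) \esum_(z in [set: X])
    (A x z * B z y * v y)%:E)%E.
  apply: eq_esum => y _.
  rewrite mulrC EFinM (actE x sA (column_dominated y sB)) -esumZl//.
    by apply: eq_esum => z _; rewrite -EFinM mulrC.
  by move=> z; rewrite lee_fin mulr_ge0.
rewrite esum_exchange; last by move=> y z; rewrite lee_fin !mulr_ge0.
apply: eq_esum => z _; rewrite EFinM (actE z sB dv) -esumZl//.
  by apply: eq_esum => y _; rewrite -EFinM mulrA.
by move=> y; rewrite lee_fin mulr_ge0.
Qed.

Lemma substochastic_matmul A B : substochastic A -> substochastic B ->
  substochastic (matmul A B).
Proof.
move=> sA sB; have dBw := act_dominated sB dominated_w; split.
  by move=> x y; apply: usum_ge0 => z; rewrite mulr_ge0//; [case: sA|case: sB].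
move=> x; rewrite (esum_act_matmul _ sA sB dominated_w).
by have := esum_act_le x sA dBw; rewrite mul1r.
Qed.

(** Tonelli's theorem. Both factors have finite entries because they are
    substochastic, so that truncating the sums to real numbers is harmless. *)
Lemma act_matmul A B K v x :
  substochastic A -> substochastic B -> dominated K v ->
  act (matmul A B) v x = act A (act B v) x.
Proof.
move=> sA sB dv; apply: EFin_inj.
rewrite (actE _ (substochastic_matmul sA sB) dv).
by rewrite (actE _ sA (act_dominated sB dv)) (esum_act_matmul _ sA sB dv).
Qed.

Lemma act_diag f v x : (forall y, 0 <= f y) -> (forall y, 0 <= v y) ->
  act (diagmat f) v x = f x * v x.
Proof.
move=> f0 v0; rewrite /act (usum_single (i := x)) /diagmat.
- by rewrite eqxx.
- by rewrite eqxx mulr1n mulr_ge0.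
- by move=> y; rewrite eq_sym => /negPf ->; rewrite mul0r.
Qed.

Lemma matmul_diagl f A x y : (forall z, 0 <= f z) ->
  (forall z t, 0 <= A z t) -> matmul (diagmat f) A x y = f x * A x y.
Proof. by move=> f0 A0; exact: (@act_diag _ (A^~ y)). Qed.

Lemma matmul_diagr f A x y : (forall z, 0 <= f z) ->
  (forall z t, 0 <= A z t) -> matmul A (diagmat f) x y = A x y * f y.
Proof.
move=> f0 A0; rewrite /matmul (usum_single (i := y)) /diagmat.
- by rewrite eqxx.
- by rewrite eqxx mulr1n mulr_ge0.
- by move=> z /negPf ->; rewrite mulr0.
Qed.

Lemma substochastic_diag f : (forall x, 0 <= f x <= 1) ->
  substochastic (diagmat f).
Proof.
move=> f01; have f0 x : 0 <= f x by case/andP: (f01 x).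
have D0 x y : 0 <= diagmat f x y by rewrite /diagmat mulrn_wge0.
split=> // x; rewrite (esum_single x) /diagmat ?eqxx.
- by rewrite lee_fin mulr1n ler_piMl ?(ltW (w_gt0 x))//; case/andP: (f01 x).
- by rewrite lee_fin mulr1n mulr_ge0 ?(ltW (w_gt0 x)).
- by move=> y; rewrite eq_sym => /negPf ->; rewrite mul0r.
Qed.

Lemma substochastic_matpow A n : substochastic A ->
  substochastic (matpow A n).
Proof.
move=> sA; elim: n => [|n IH].
  by apply: substochastic_diag => x; rewrite ler01 lexx.
exact: substochastic_matmul.
Qed.

Lemma act_matpow A n K v x : substochastic A -> dominated K v ->
  act (matpow A n) v x = iter n (act A) v x.
Proof.
move=> sA; elim: n v => [|n IH] v dv.
  by rewrite act_diag ?mul1r// => y; exact: dominated_ge0 dv.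
rewrite iterSr -IH; last exact: act_dominated.
by rewrite -(act_matmul _ (substochastic_matpow n sA) sA dv).
Qed.

End Action.

(** * Cleaning steps and their products *)

Section CleaningSweeps.
Context {R : realType} {X : countType}.
Set Implicit Arguments.
Unset Strict Implicit.
Variables (alpha : X -> X -> R) (w : X -> R) (L : set X).
Hypothesis alpha_ge0 : forall x y, 0 <= alpha x y.
Hypothesis w_gt0 : forall x, 0 < w x.
Hypothesis alpha_w : subinvariant alpha w.
Implicit Types (u v f : X -> R) (K : R) (x y : X).

Lemma substochastic_alpha : substochastic w alpha.
Proof. by []. Qed.
Let sa := substochastic_alpha.

Lemma indic01 x : 0 <= (\1_L x : R) <= 1.
Proof. by rewrite indicE ler0n lern1 leq_b1. Qed.

Lemma indic_ge0 x : 0 <= (\1_L x : R).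
Proof. by case/andP: (indic01 x). Qed.

Lemma substochastic_setmat : substochastic w (setmat L : X -> X -> R).
Proof. exact: substochastic_diag indic01. Qed.

Lemma substochastic_setmat_alpha : substochastic w (matmul (setmat L) alpha).
Proof. exact: substochastic_matmul substochastic_setmat sa. Qed.

Lemma substochastic_restricted : substochastic w (restricted alpha L).
Proof.
exact: substochastic_matmul substochastic_setmat_alpha substochastic_setmat.
Qed.

Lemma act_setmat_alpha K v x : dominated w K v ->
  act (matmul (setmat L) alpha) v x = \1_L x * act alpha v x.
Proof.
move=> dv; rewrite (act_matmul w_gt0 _ substochastic_setmat sa dv).
have dav := act_dominated w_gt0 sa dv.
by rewrite act_diag => // y; exact: dominated_ge0 dav.
Qed.

Lemma act_restricted K v x : dominated w K v -> (forall y, ~ L y -> v y = 0) ->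
  act (restricted alpha L) v x = \1_L x * act alpha v x.
Proof.
move=> dv vL; rewrite -(act_setmat_alpha _ dv).
rewrite (act_matmul w_gt0 _ substochastic_setmat_alpha substochastic_setmat dv).
apply: eq_act => y; rewrite act_diag; last 2 first.
- exact: indic_ge0.
- by move=> z; exact: dominated_ge0 dv.
have [Ly|nLy] := pselect (L y); first by rewrite indicE mem_set// mul1r.
by rewrite (vL _ nLy) mulr0.
Qed.

Lemma esum_act_cleaning f K v x : (forall y, 0 <= f y <= 1) ->
  dominated w K v ->
  (\esum_(y in [set: X]) (cleaning alpha f x y * v y)%:E =
   ((1 - f x) * v x + f x * act alpha v x)%:E)%E.
Proof.
move=> f01 dv; have f0 y : 0 <= f y by case/andP: (f01 y).
have v0 y : 0 <= v y := dominated_ge0 y dv.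
have f1 y : 0 <= 1 - f y by rewrite subr_ge0; case/andP: (f01 y).
under eq_esum do rewrite /cleaning /matadd matmul_diagl// mulrDl EFinD.
rewrite esumD; last 2 first.
- by move=> y _; rewrite lee_fin mulr_ge0// mulrn_wge0.
- by move=> y _; rewrite lee_fin !mulr_ge0.
rewrite EFinD; congr (_ + _)%E.
  rewrite (esum_single x) /diagmat ?eqxx.
  - by [].
  - by rewrite lee_fin mulr1n mulr_ge0.
  - by move=> y; rewrite eq_sym => /negPf ->; rewrite mul0r.
rewrite EFinM (actE w_gt0 _ sa dv) -esumZl//; last first.
  by move=> y; rewrite lee_fin mulr_ge0.
by apply: eq_esum => y _; rewrite -EFinM mulrA.
Qed.

Lemma substochastic_cleaning f : (forall y, 0 <= f y <= 1) ->
  substochastic w (cleaning alpha f).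
Proof.
move=> f01; have f0 y : 0 <= f y by case/andP: (f01 y).
split=> [x y|x].
  rewrite /cleaning /matadd matmul_diagl// addr_ge0 ?mulr_ge0//.
  by rewrite mulrn_wge0// subr_ge0; case/andP: (f01 x).
rewrite (esum_act_cleaning _ f01 (dominated_w w_gt0)) lee_fin.
have := act_dominated w_gt0 sa (dominated_w w_gt0) x.
move: (f01 x) (w_gt0 x) => /andP[fx0 fx1] wx /andP[_]; rewrite mul1r => aw.
have : f x * act alpha w x <= f x * w x by rewrite ler_wpM2l.
lra.
Qed.

Lemma act_cleaning f K v x : (forall y, 0 <= f y <= 1) -> dominated w K v ->
  act (cleaning alpha f) v x = (1 - f x) * v x + f x * act alpha v x.
Proof.
move=> f01 dv; apply: EFin_inj.
rewrite (actE w_gt0 _ (substochastic_cleaning f01) dv).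
exact: esum_act_cleaning f01 dv.
Qed.

Variable g : nat -> X -> R.
Hypothesis g_range : forall i x, 0 <= g i x <= \1_L x.

Lemma g01 i x : 0 <= g i x <= 1.
Proof.
case/andP: (g_range i x) => -> /= /le_trans; apply.
by case/andP: (indic01 x).
Qed.

Lemma g_off i x : ~ L x -> g i x = 0.
Proof.
move=> nLx; apply/eqP; rewrite eq_le; have := g_range i x.
by rewrite indicE memNset// => /andP[-> ->].
Qed.

Let clean i := cleaning alpha (g i).
Let sc i : substochastic w (clean i) := substochastic_cleaning (g01 i).

(** The first index of [s] acts last, as the leftmost factor of a product. *)
Definition sweep (s : seq nat) v : X -> R :=
  foldr (fun i u => act (cleaning alpha (g i)) u) v s.

Lemma sweep_dominated K s v : dominated w K v -> dominated w K (sweep s v).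
Proof.
by move=> dv; elim: s => //= i s IH; exact: act_dominated (sc i) IH.
Qed.

Lemma sweep_le K s u v x : (forall y, 0 <= u y <= v y) -> dominated w K v ->
  sweep s u x <= sweep s v x.
Proof.
move=> uv dv; have du := dominated_le uv dv.
elim: s x => [|i s IH] x /=; first by case/andP: (uv x).
apply: (act_le w_gt0 _ (sc i) _ (sweep_dominated s dv)) => y.
by rewrite IH andbT (dominated_ge0 y (sweep_dominated s du)).
Qed.

Lemma sweep_linear K K' r s u v x : 0 <= r ->
  dominated w K u -> dominated w K' v ->
  sweep s (fun y => u y + r * v y) x = sweep s u x + r * sweep s v x.
Proof.
move=> r0 du dv; elim: s x => [//|i s IH] x /=.
have dsv := sweep_dominated s dv.
rewrite (eq_act _ _ IH).
rewrite (actD w_gt0 _ (sc i) (sweep_dominated s du) (dominatedZ r0 dsv)).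
by rewrite (actZ w_gt0 _ (sc i) r0 dsv).
Qed.

(** As [g i] and [v] both vanish off [L], only the restricted part of [alpha]
    is seen. This is the relaxation form of a cleaning step: [v x] moves the
    fraction [g i x] of the way towards its image. *)
Lemma act_cleaning_supported K i v x : dominated w K v ->
  (forall y, ~ L y -> v y = 0) ->
  act (clean i) v x = v x + g i x * (act (restricted alpha L) v x - v x).
Proof.
move=> dv vL; rewrite (act_cleaning _ (g01 i) dv) (act_restricted _ dv vL).
have [Lx|nLx] := pselect (L x); last by rewrite (g_off _ nLx); ring.
by rewrite indicE mem_set// mulr1n; ring.
Qed.

Lemma sweep_supported K s v x : dominated w K v ->
  (forall y, ~ L y -> v y = 0) -> ~ L x -> sweep s v x = 0.
Proof.
move=> dv vL; elim: s x => [|i s IH] x nLx /=; first exact: vL.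
rewrite (act_cleaning_supported _ _ (sweep_dominated s dv))//.
by rewrite g_off// mul0r addr0 IH.
Qed.

Section Superharmonic.
Variables (K : R) (v : X -> R).
Hypothesis dv : dominated w K v.
Hypothesis vL : forall y, ~ L y -> v y = 0.
Hypothesis v_super : forall x, act (restricted alpha L) v x <= v x.

Lemma act_restricted_sweep_le s x : (forall y, sweep s v y <= v y) ->
  act (restricted alpha L) (sweep s v) x <= act (restricted alpha L) v x.
Proof.
move=> sv; apply: (act_le w_gt0 _ substochastic_restricted _ dv) => y.
by rewrite sv (dominated_ge0 y (sweep_dominated s dv)).
Qed.

Lemma sweep_le_id s x : sweep s v x <= v x.
Proof.
elim: s x => [//|i s IH] x /=.
rewrite (act_cleaning_supported _ _ (sweep_dominated s dv)); last first.
  by move=> y; exact: sweep_supported dv vL.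
have le1 := le_trans (act_restricted_sweep_le x IH) (v_super x).
have := IH x; case/andP: (g01 i x); nra.
Qed.

(** Each step multiplies the excess of the current function over the
    restricted matrix acting on [v] by at most [1 - g i x], and
    [(1 - g) * (1 + g + S) <= 1 + S]: so the total amount of cleaning at [x]
    bounds the part of the excess that survives. *)
Lemma sweep_excess s x :
  (1 + \sum_(i <- s) g i x) * (sweep s v x - act (restricted alpha L) v x) <=
  v x - act (restricted alpha L) v x.
Proof.
elim: s => [|i s IH] /=; first by rewrite big_nil addr0 mul1r.
rewrite big_cons (act_cleaning_supported _ _ (sweep_dominated s dv)); last first.
  by move=> y; exact: sweep_supported dv vL.
have := act_restricted_sweep_le x (sweep_le_id s).
set r := act _ v x in IH *; set r' := act _ (sweep s v) x.
set u := sweep s v x in IH *; set S := (\sum_(_ <- _) _) in IH *.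
move=> r'r; have S0 : 0 <= S.
  by apply: sumr_ge0 => j _; case/andP: (g_range j x).
have rv : r <= v x := v_super x.
have /andP[] := g01 i x; move: (g i x) => t t0 t1.
have step : (1 + (t + S)) * (u + t * (r' - u) - r) <=
    (1 + (t + S)) * ((1 - t) * (u - r)).
  apply: ler_wpM2l; first by rewrite !addr_ge0.
  rewrite -subr_ge0 (_ : _ - _ = t * (r - r')); last by ring.
  by rewrite mulr_ge0// subr_ge0.
apply: le_trans step _; have [ur|ru] := leP u r.
  apply: (@le_trans _ _ 0); last by rewrite subr_ge0.
  by rewrite mulr_ge0_le0 ?addr_ge0// mulr_ge0_le0 ?subr_ge0 ?subr_le0.
apply: le_trans IH; rewrite mulrA; apply: ler_wpM2r; first by rewrite subr_ge0 ltW.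
rewrite -subr_ge0 (_ : _ - _ = t * (t + S)); last by ring.
by rewrite mulr_ge0// addr_ge0.
Qed.

End Superharmonic.

(** * Decay of the mass left in [L] *)

Definition inner : X -> R := fun x => \1_L x * w x.
(** A decreasing sequence of superharmonic functions for the restricted
    matrix. *)
Definition inner_iter l : X -> R := iter l (act (restricted alpha L)) inner.

Lemma inner_le_w x : 0 <= inner x <= w x.
Proof.
case/andP: (indic01 x) => i0 i1; have w0 := ltW (w_gt0 x).
by rewrite /inner mulr_ge0// ler_piMl.
Qed.

Lemma inner_dominated : dominated w 1 inner.
Proof. exact: dominated_le inner_le_w (dominated_w w_gt0). Qed.

Lemma inner_off x : ~ L x -> inner x = 0.
Proof. by move=> nLx; rewrite /inner indicE memNset// mul0r. Qed.

Lemma inner_iter_dominated l : dominated w 1 (inner_iter l).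
Proof.
elim: l => [|l IH]; first exact: inner_dominated.
rewrite /inner_iter/=; apply: act_dominated; last exact: IH; first exact: w_gt0.
exact: substochastic_restricted.
Qed.

Lemma inner_iter_off l x : ~ L x -> inner_iter l x = 0.
Proof.
elim: l x => [|l IH] x nLx; first exact: inner_off.
rewrite /inner_iter/= (act_restricted _ (inner_iter_dominated l) IH).
by rewrite indicE memNset// mul0r.
Qed.

(** The case [l = 0] is [alpha w <= w]; monotonicity does the rest. *)
Lemma inner_iterS_le l x : inner_iter l.+1 x <= inner_iter l x.
Proof.
elim: l x => [|l IH] x.
  rewrite /inner_iter/= (act_restricted _ inner_dominated inner_off).
  rewrite /inner ler_wpM2l ?indic_ge0//.
  have /andP[_] := act_dominated w_gt0 sa inner_dominated x.
  by rewrite mul1r.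
apply: (act_le w_gt0 _ substochastic_restricted _ (inner_iter_dominated l)) => y.
by rewrite IH andbT (dominated_ge0 y (inner_iter_dominated l.+1)).
Qed.

Lemma inner_iter_le l x : inner_iter l x <= inner x.
Proof.
by elim: l => [//|l IH]; exact: le_trans (inner_iterS_le l x) IH.
Qed.

Lemma inner_iter_le_act_matpow l x :
  inner_iter l x <= act (matpow (restricted alpha L) l) w x.
Proof.
have dw := dominated_w w_gt0.
rewrite (act_matpow w_gt0 _ _ substochastic_restricted dw).
elim: l x => [|l IH] x /=; first by case/andP: (inner_le_w x).
have dk : dominated w 1 (iter l (act (restricted alpha L)) w).
  elim: l {IH} => [//|l IH]; exact: act_dominated substochastic_restricted IH.
apply: (act_le w_gt0 _ substochastic_restricted _ dk) => y.
by rewrite IH andbT (dominated_ge0 y (inner_iter_dominated l)).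
Qed.

Hypothesis g_diverges : forall M : R, exists N : nat,
  forall x, L x -> M <= \sum_(0 <= i < N) g i x.

(** Discarding the first [n] steps loses at most [n], as each is at most
    [1]. *)
Lemma tail_diverges (M : R) n : exists2 N, (n <= N)%N &
  forall x, L x -> M <= \sum_(n <= i < N) g i x.
Proof.
have [N MN] := g_diverges (M + n%:R).
exists (maxn n N) => [|x Lx]; first exact: leq_maxl.
have g0 i : 0 <= g i x by case/andP: (g_range i x).
have le_n : \sum_(0 <= i < n) g i x <= n%:R.
  apply: (@le_trans _ _ (\sum_(0 <= i < n) 1)).
    by apply: ler_sum => i _; case/andP: (g01 i x).
  by rewrite big_const_nat subn0 iter_addr_0.
have le_max : \sum_(0 <= i < N) g i x <= \sum_(0 <= i < maxn n N) g i x.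
  rewrite [leRHS](big_cat_nat (n := N)) ?leq_maxr//= lerDl.
  exact: sumr_ge0.
have split_max : \sum_(0 <= i < maxn n N) g i x =
    \sum_(0 <= i < n) g i x + \sum_(n <= i < maxn n N) g i x.
  by rewrite (big_cat_nat (n := n)) ?leq_maxl.
by have := MN x Lx; lra.
Qed.

Lemma index_iota_cat (m n p : nat) : (m <= n <= p)%N ->
  index_iota m p = index_iota m n ++ index_iota n p.
Proof.
move=> /andP[mn np]; rewrite /index_iota.
have -> : (p - m = (n - m) + (p - n))%N by rewrite addnC addnBA// subnK.
by rewrite iotaD subnKC.
Qed.

(** Induction on [l], peeling off the leftmost block: if its total cleaning is
    at least [2 / e] on [L], it amounts to one application of the restricted
    matrix up to [e / 2] times [inner]. The steps to its right are approximated
    with the remaining tolerance [e / 2], and the block does not increase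
    [inner], hence does not amplify their error. *)
Lemma sweep_inner_le l (e : R) n : 0 < e -> exists N0, forall N, (N0 <= N)%N ->
  forall x, sweep (index_iota n N) inner x <= inner_iter l x + e * inner x.
Proof.
elim: l e n => [|l IH] e n e0.
  exists 0%N => N _ x; rewrite /inner_iter/=.
  apply: le_trans (sweep_le_id inner_dominated inner_off (inner_iterS_le 0) _ x) _.
  by rewrite lerDl mulr_ge0 ?(ltW e0)//; case/andP: (inner_le_w x).
have e2 : 0 < e / 2 by lra.
have [N1 nN1 block] := tail_diverges (2 / e) n.
have [N0 HN0] := IH _ N1 e2.
exists (maxn N0 N1) => N; rewrite geq_max => /andP[N0N N1N] x.
have [Lx|nLx] := pselect (L x); last first.
  by rewrite (sweep_supported _ inner_dominated inner_off nLx)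
    inner_iter_off// inner_off// mulr0 addr0.
rewrite (@index_iota_cat _ N1) ?nN1// /sweep foldr_cat.
rewrite -/(sweep (index_iota N1 N) inner) -/(sweep (index_iota n N1) _).
have din := inner_iter_dominated l.
have dsum := dominatedD din (dominatedZ (ltW e2) inner_dominated).
have tail y : 0 <= sweep (index_iota N1 N) inner y <=
    inner_iter l y + e / 2 * inner y.
  by rewrite HN0// (dominated_ge0 y (sweep_dominated _ inner_dominated)).
apply: le_trans (sweep_le _ x tail dsum) _.
rewrite (sweep_linear _ _ (ltW e2) din inner_dominated).
have excess := sweep_excess din (@inner_iter_off l) (inner_iterS_le l)
  (index_iota n N1) x.
have := sweep_le_id inner_dominated inner_off (inner_iterS_le 0)
  (index_iota n N1) x.
have := block x Lx; have := inner_iter_le l x.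
have : 0 <= act (restricted alpha L) (inner_iter l) x.
  exact: dominated_ge0 (inner_iter_dominated l.+1).
have : 0 <= inner x by case/andP: (inner_le_w x).
move: excess; rewrite /index_iota.
rewrite -[inner_iter l.+1 x]/(act (restricted alpha L) (inner_iter l) x).
set S := \sum_(_ <- _) _; set r := act _ _ x; set a := sweep _ _ x.
set b := sweep _ inner x => excess i0 r0 li S_ge bi.
have arb : e / 2 * b <= e / 2 * inner x by rewrite ler_wpM2l// ltW.
suff : a - r <= e / 2 * inner x by lra.
have [ar|ra] := leP a r.
  by apply: (@le_trans _ _ 0); [lra|rewrite mulr_ge0// ltW].
have : 2 / e * (a - r) <= inner x.
  apply: (@le_trans _ _ ((1 + S) * (a - r))); last lra.
  by rewrite ler_wpM2r; lra.
by rewrite mulrC mulrA ler_pdivrMr//; lra.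
Qed.

End CleaningSweeps.

(** * The balayage matrix *)

Section Balayage.
Context {R : realType} {X : countType}.
Set Implicit Arguments.
Unset Strict Implicit.
Variables (alpha : X -> X -> R) (w : X -> R) (L : set X).
Hypothesis alpha_ge0 : forall x y, 0 <= alpha x y.
Hypothesis w_gt0 : forall x, 0 < w x.
Hypothesis alpha_w : subinvariant alpha w.
Implicit Types (u v e f : X -> R) (K : R) (x y : X).

Let sa : substochastic w alpha := conj alpha_ge0 alpha_w.
Let Q := matmul (setmat L) alpha.
Let sQ : substochastic w Q := substochastic_setmat_alpha L alpha_ge0 w_gt0 alpha_w.
Let sIc : substochastic w (setmat (~` L) : X -> X -> R) :=
  substochastic_setmat (~` L) w_gt0.
Let dw := dominated_w w_gt0.

Definition balayage_term k : X -> X -> R :=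
  matmul (matpow Q k) (setmat (~` L)).

Let sT k : substochastic w (balayage_term k) :=
  substochastic_matmul w_gt0 (substochastic_matpow w_gt0 k sQ) sIc.

Lemma dominated_sum K (u : nat -> X -> R) n : (forall k, dominated w K (u k)) ->
  dominated w (K *+ n) (fun x => \sum_(0 <= k < n) u k x).
Proof.
move=> du; elim: n => [|n IH] x.
  by rewrite big_nil mulr0n mul0r lexx.
have := dominatedD IH (du n) x.
by rewrite big_nat_recr//= mulrSr.
Qed.

Lemma act_sum A K (u : nat -> X -> R) n x : substochastic w A ->
  (forall k, dominated w K (u k)) ->
  act A (fun y => \sum_(0 <= k < n) u k y) x = \sum_(0 <= k < n) act A (u k) x.
Proof.
move=> sA du; elim: n => [|n IH].
  rewrite big_nil -[RHS](mul0r (act A (u 0%N) x)).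
  rewrite -(actZ w_gt0 _ sA (lexx 0) (du 0%N)).
  by apply: eq_act => y; rewrite big_nil mul0r.
rewrite big_nat_recr//= -IH -(actD w_gt0 _ sA (dominated_sum n du) (du n)).
by apply: eq_act => y; rewrite big_nat_recr.
Qed.

(** The partial sums satisfy [s (n + 1) = e + Q (s n)] where [e] lives off [L]
    and [Q (s n)] on [L], so that the bound by [K * w] is never exceeded. *)
Lemma partial_balayage_le e K n x : dominated w K e ->
  (forall y, L y -> e y = 0) ->
  \sum_(0 <= k < n) iter k (act Q) e x <= K * w x.
Proof.
move=> de eL.
have dk k : dominated w K (iter k (act Q) e).
  by elim: k => [//|k IH]; apply: act_dominated sQ IH.
elim: n x => [|n IH] x.
  rewrite big_nil; have /andP[e0] := de x; exact: le_trans.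
rewrite big_nat_recl//= -(act_sum n x sQ dk).
have ds : dominated w K (fun y => \sum_(0 <= k < n) iter k (act Q) e y).
  by move=> y; rewrite IH andbT; exact: dominated_ge0 (dominated_sum n dk).
rewrite (act_setmat_alpha L alpha_ge0 w_gt0 alpha_w x ds) indicE.
have [Lx|nLx] := pselect (L x).
  rewrite mem_set// mul1r eL// add0r.
  by case/andP: (act_dominated w_gt0 sa ds x).
by rewrite memNset// mul0r addr0; case/andP: (de x).
Qed.

Lemma balayage_termE k x y :
  balayage_term k x y = iter k (act Q) ((setmat (~` L) : X -> X -> R)^~ y) x.
Proof.
by rewrite -(act_matpow w_gt0 _ _ sQ (column_dominated w_gt0 y sIc)).
Qed.

Lemma act_balayage_term k x :
  act (balayage_term k) w x = iter k (act Q) (act (setmat (~` L)) w) x.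
Proof.
rewrite (act_matmul w_gt0 x (substochastic_matpow w_gt0 k sQ) sIc dw).
by rewrite (act_matpow w_gt0 _ _ sQ (act_dominated w_gt0 sIc dw)).
Qed.

Lemma setmatC_in x y : L x -> (setmat (~` L) : X -> X -> R) x y = 0.
Proof.
by move=> Lx; rewrite /setmat /diagmat indicE memNset ?mul0rn//; exact.
Qed.

Lemma balayage_term_ge0 k x y : 0 <= balayage_term k x y.
Proof. by case: (sT k). Qed.

(** The partial sums of the series are bounded by [w x / w y], so its sum is
    finite. *)
Lemma balayageE x y : (balayage alpha L x y)%:E =
  (\esum_(k in [set: nat]) (balayage_term k x y)%:E)%E.
Proof.
have T0 k : (0 <= (balayage_term k x y)%:E)%E.
  by rewrite lee_fin balayage_term_ge0.
rewrite -nneseries_esumT// /balayage -/Q fineK//.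
rewrite ge0_fin_numE; last by apply: nneseries_ge0 => k _ _; exact: T0.
apply: (@le_lt_trans _ _ ((w y)^-1 * w x)%:E); last exact: ltry.
apply: lime_le; first by apply: is_cvg_nneseries => k _ _; exact: T0.
apply: nearW => n; rewrite sumEFin lee_fin.
under eq_bigr do rewrite [matmul _ _ _ _]balayage_termE.
apply: partial_balayage_le (column_dominated w_gt0 y sIc) _ => z.
exact: setmatC_in.
Qed.

(** Exchanging sums, this is the bound on the partial sums started from [w]
    restricted to the complement of [L]. *)
Lemma substochastic_balayage : substochastic w (balayage alpha L).
Proof.
split=> x => [y|].
  rewrite -lee_fin balayageE esum_ge0// => k _.
  by rewrite lee_fin balayage_term_ge0.
have T0 k y : 0 <= balayage_term k x y * w y.
  by rewrite mulr_ge0 ?balayage_term_ge0 ?ltW.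
rewrite (eq_esum (b := fun y =>
    \esum_(k in [set: nat]) (balayage_term k x y * w y)%:E)%E); last first.
  move=> y _; rewrite mulrC EFinM balayageE -esumZl ?ltW//.
    by apply: eq_esum => k _; rewrite -EFinM mulrC.
  by move=> k; rewrite lee_fin balayage_term_ge0.
rewrite esum_exchange; last by move=> y k; rewrite lee_fin.
rewrite (eq_esum (b := fun k => (act (balayage_term k) w x)%:E)); last first.
  by move=> k _; rewrite (actE w_gt0 _ (sT k) dw).
have act0 k : (0 <= (act (balayage_term k) w x)%:E)%E.
  by rewrite lee_fin; apply: usum_ge0.
rewrite -nneseries_esumT//.
apply: lime_le; first by apply: is_cvg_nneseries => k _ _; exact: act0.
apply: nearW => n; rewrite sumEFin lee_fin.
under eq_bigr do rewrite act_balayage_term.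
rewrite -[leRHS]mul1r.
apply: partial_balayage_le (act_dominated w_gt0 sIc dw) _ => y Ly.
rewrite act_diag; last 2 first.
- by move=> z; exact: indic_ge0.
- by move=> z; exact: ltW.
by rewrite indicE memNset ?mul0r//; exact.
Qed.

Lemma act_setmat_alpha_off K v x : dominated w K v -> ~ L x -> act Q v x = 0.
Proof.
move=> dv nLx; rewrite (act_setmat_alpha L alpha_ge0 w_gt0 alpha_w x dv).
by rewrite indicE memNset// mul0r.
Qed.

Lemma iter_setmat_alpha_dominated k y : dominated w (w y)^-1
  (iter k (act Q) ((setmat (~` L) : X -> X -> R)^~ y)).
Proof.
elim: k => [|k IH] /=; first exact: column_dominated.
by apply: act_dominated sQ IH.
Qed.

Lemma balayage_off x y : ~ L x -> balayage alpha L x y = setmat (~` L) x y.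
Proof.
move=> nLx; apply: EFin_inj; rewrite balayageE (esum_single 0%N).
- by rewrite balayage_termE.
- by rewrite lee_fin balayage_term_ge0.
case=> // k _; rewrite balayage_termE/=.
by rewrite (act_setmat_alpha_off (iter_setmat_alpha_dominated k y)).
Qed.

(** Each term of the series is obtained from the preceding one by acting with
    [Q]; on [L] the first term vanishes, so the sum is a fixed point. *)
Lemma balayage_in x y : L x ->
  balayage alpha L x y = act alpha ((balayage alpha L)^~ y) x.
Proof.
move=> Lx; apply: EFin_inj.
have dP := column_dominated w_gt0 y substochastic_balayage.
rewrite (actE w_gt0 _ sa dP).
transitivity (\esum_(z in [set: X]) \esum_(k in [set: nat])
    (alpha x z * balayage_term k z y)%:E)%E; last first.
  apply: eq_esum => z _; rewrite EFinM balayageE -esumZl//.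
  by move=> k; rewrite lee_fin balayage_term_ge0.
rewrite esum_exchange; last first.
  by move=> z k; rewrite lee_fin mulr_ge0// balayage_term_ge0.
rewrite balayageE -nneseries_esumT; last first.
  by move=> k; rewrite lee_fin balayage_term_ge0.
rewrite nneseries_recl//; last by move=> k _; rewrite lee_fin balayage_term_ge0.
rewrite balayage_termE/= setmatC_in// add0e.
rewrite -nneseries_addn//; last first.
  by move=> k; rewrite lee_fin balayage_term_ge0.
rewrite nneseries_esumT; last by move=> k; rewrite lee_fin balayage_term_ge0.
apply: eq_esum => k _; rewrite addn1 balayage_termE/=.
have dk := iter_setmat_alpha_dominated k y.
rewrite (act_setmat_alpha L alpha_ge0 w_gt0 alpha_w x dk).
rewrite indicE mem_set// mul1r (actE w_gt0 _ sa dk).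
by apply: eq_esum => z _; rewrite balayage_termE.
Qed.

Lemma act_cleaning_balayage f x y : (forall z, 0 <= f z <= \1_L z) ->
  act (cleaning alpha f) ((balayage alpha L)^~ y) x = balayage alpha L x y.
Proof.
move=> f_range; have f01 z : 0 <= f z <= 1.
  case/andP: (f_range z) => -> /= /le_trans; apply.
  by case/andP: (indic01 (R := R) L z).
have dP := column_dominated w_gt0 y substochastic_balayage.
rewrite (act_cleaning alpha_ge0 w_gt0 alpha_w x f01 dP).
have [Lx|nLx] := pselect (L x); first by rewrite -balayage_in//; ring.
have -> : f x = 0.
  by apply/eqP; rewrite eq_le; have := f_range x; rewrite indicE memNset// andbC.
by rewrite subr0 mul1r mul0r addr0.
Qed.

Lemma sweep_balayage (g : nat -> X -> R) s x y :
  (forall i z, 0 <= g i z <= \1_L z) ->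
  sweep alpha g s ((balayage alpha L)^~ y) x = balayage alpha L x y.
Proof.
move=> g_range; elim: s x => [//|i s IH] x /=.
by rewrite (eq_act _ _ IH) act_cleaning_balayage.
Qed.

(** If [P] fixes the balayage matrix then [P - Pi = P (I - Pi)], and the rows of
    [I - Pi] off [L] vanish; the two terms of the bound are the two terms of
    [P I_L - P I_L Pi]. *)
Lemma sub_balayage_le P x : substochastic w P ->
  (forall y, act P ((balayage alpha L)^~ y) x = balayage alpha L x y) ->
  (\esum_(y in [set: X]) (`|matsub P (balayage alpha L) x y| * w y)%:E <=
   (2 * act P (inner w L) x)%:E)%E.
Proof.
move=> sP fixP; have sPi := substochastic_balayage.
have sI := substochastic_setmat L w_gt0.
pose M := matmul (setmat L) (balayage alpha L).
have sM : substochastic w M by exact: substochastic_matmul.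
have P0 : forall x y, 0 <= P x y by case: sP.
have Pi0 : forall x y, 0 <= balayage alpha L x y by case: sPi.
have PM := substochastic_matmul w_gt0 sP sM.
have PM0 : forall x y, 0 <= matmul P M x y by case: PM.
have w0 y := ltW (w_gt0 y).
have ME z y : M z y = \1_L z * balayage alpha L z y.
  by rewrite /M matmul_diagl//; exact: indic_ge0.
have din := inner_dominated L w_gt0.
have split_Pi y : balayage alpha L x y =
    matmul P M x y + P x y * \1_(~` L) y.
  rewrite -fixP -(matmul_diagr _ _ _ P0); last exact: indic_ge0.
  rewrite -[matmul P M x y]/(act P (M^~ y) x).
  rewrite -[matmul P _ x y]/(act P ((setmat (~` L) : X -> X -> R)^~ y) x).
  rewrite -(actD w_gt0 _ sP (column_dominated w_gt0 y sM)
    (column_dominated w_gt0 y sIc)).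
  apply: eq_act => z; rewrite ME indicE.
  have [Lz|nLz] := pselect (L z).
    by rewrite mem_set// mul1r setmatC_in// addr0.
  by rewrite memNset// mul0r add0r balayage_off.
have bound y : `|matsub P (balayage alpha L) x y| * w y <=
    P x y * inner w L y + matmul P M x y * w y.
  have -> : matsub P (balayage alpha L) x y =
      P x y * \1_L y - matmul P M x y.
    rewrite /matsub split_Pi !indicE in_setC.
    by case: (y \in L); rewrite /= ?mulr1n ?mulr0n; ring.
  rewrite /inner mulrA -mulrDl ler_wpM2r//.
  apply: le_trans (ler_normB _ _) _.
  by rewrite !ger0_norm// mulr_ge0// indic_ge0.
apply: (@le_trans _ _ (\esum_(y in [set: X])
    ((P x y * inner w L y)%:E + (matmul P M x y * w y)%:E))%E).
  by apply: le_esum => y _; rewrite -EFinD lee_fin.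
rewrite esumD; last 2 first.
- by move=> y _; rewrite lee_fin mulr_ge0// (dominated_ge0 _ din).
- by move=> y _; rewrite lee_fin mulr_ge0.
rewrite -(actE w_gt0 _ sP din) -(actE w_gt0 _ PM dw) -EFinD lee_fin.
rewrite (act_matmul w_gt0 x sP sM dw) mulr2n mulrDl mul1r lerD2l.
apply: (act_le w_gt0 _ sP _ din) => z.
rewrite (dominated_ge0 z (act_dominated w_gt0 sM dw))/=.
rewrite /M (act_matmul w_gt0 z sI sPi dw) act_diag; last 2 first.
- exact: indic_ge0.
- by move=> t; exact: dominated_ge0 (act_dominated w_gt0 sPi dw).
rewrite /inner ler_wpM2l ?indic_ge0//.
by have /andP[_] := act_dominated w_gt0 sPi dw z; rewrite mul1r.
Qed.

End Balayage.

(** * Weighted norms *)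

Section Norms.
Context {R : realType} {X : countType}.
Set Implicit Arguments.
Unset Strict Implicit.
Variable w : X -> R.
Hypothesis w_gt0 : forall x, 0 < w x.
Implicit Types (A : X -> X -> R) (c : X -> R) (x y : X).

Let w0 x : 0 <= w x := ltW (w_gt0 x).

Lemma wnorm_ge0 c : (0 <= wnorm w c)%E.
Proof. by apply: esum_ge0 => x _; rewrite lee_fin mulr_ge0. Qed.

Lemma wnorm_vecmul_le c A :
  (wnorm w (vecmul c A) <= \esum_(x in [set: X])
     (`|c x|%:E * \esum_(y in [set: X]) (`|A x y| * w y)%:E))%E.
Proof.
apply: (@le_trans _ _ (\esum_(y in [set: X]) \esum_(x in [set: X])
    (`|c x| * (`|A x y| * w y))%:E)%E).
  apply: le_esum => y _.
  rewrite mulrC EFinM (eq_esum (b := fun x => (w y)%:E * `|c x * A x y|%:E)%E).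
    rewrite esumZl//; apply: lee_wpmul2l; first by rewrite lee_fin.
    exact: abs_usum_le.
  by move=> x _; rewrite -EFinM normrM mulrA mulrC.
rewrite esum_exchange; last by move=> y x; rewrite lee_fin !mulr_ge0.
apply: le_esum => x _; rewrite -esumZl//.
by move=> y; rewrite lee_fin mulr_ge0.
Qed.

(** Finiteness of the norm of [c] makes the entries of [c A] finite, and then the
    equality is Tonelli's theorem. *)
Lemma wnorm_vecmul c A : (forall x, 0 <= c x) -> (wnorm w c < +oo)%E ->
  substochastic w A ->
  wnorm w (vecmul c A) = (\esum_(x in [set: X]) (c x * act A w x)%:E)%E.
Proof.
move=> c0 cfin sA; have A0 : forall x y, 0 <= A x y by case: sA.
have cE : wnorm w c = (\esum_(x in [set: X]) (c x * w x)%:E)%E.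
  by apply: eq_esum => x _; rewrite ger0_norm.
have vecmulE y : (vecmul c A y)%:E = (\esum_(x in [set: X]) (c x * A x y)%:E)%E.
  rewrite usumE//; first by move=> x; rewrite mulr_ge0.
  apply: (@le_lt_trans _ _ ((w y)^-1%:E * wnorm w c)%E); last first.
    by rewrite lte_mul_pinfty// lee_fin invr_ge0.
  rewrite cE -esumZl ?invr_ge0//; last by move=> x; rewrite lee_fin mulr_ge0.
  apply: le_esum => x _; rewrite -EFinM lee_fin mulrCA ler_wpM2l//.
  by case/andP: (column_dominated w_gt0 y sA x).
transitivity (\esum_(y in [set: X]) \esum_(x in [set: X])
    (c x * (A x y * w y))%:E)%E.
  apply: eq_esum => y _; rewrite ger0_norm; last first.
    by apply: usum_ge0 => x; rewrite mulr_ge0.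
  rewrite mulrC EFinM vecmulE -esumZl//.
    by apply: eq_esum => x _; rewrite -EFinM mulrC mulrA.
  by move=> x; rewrite lee_fin mulr_ge0.
rewrite esum_exchange; last by move=> y x; rewrite lee_fin !mulr_ge0.
apply: eq_esum => x _; rewrite EFinM (actE w_gt0 _ sA (dominated_w w_gt0)).
by rewrite -esumZl// => y; rewrite lee_fin mulr_ge0.
Qed.

Lemma wnorm_finite_support c : finite_set [set x | c x != 0] ->
  (wnorm w c < +oo)%E.
Proof.
move=> fin; rewrite /wnorm.
rewrite (eq_esum (b := fun x => if x \in [set x | c x != 0]
  then (`|c x| * w x)%:E else 0%E)); last first.
  move=> x _; case: ifPn => //; rewrite notin_setE/= => /negP/negPn/eqP ->.
  by rewrite normr0 mul0r.
rewrite -esum_mkcond esum_fset//; last first.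
  by move=> x _; rewrite lee_fin mulr_ge0.
by rewrite fsumEFin// ltry.
Qed.

Lemma wnorm_gt0 c x : c x != 0 -> (0 < wnorm w c)%E.
Proof.
move=> cx; apply: (@lt_le_trans _ _ (`|c x| * w x)%:E).
  by rewrite lte_fin mulr_gt0// normr_gt0.
rewrite -(@esum_set1 _ _ x (fun z => (`|c z| * w z)%:E)); last first.
  by rewrite lee_fin mulr_ge0.
rewrite esum_mkcond; apply: le_esum => z _; case: ifPn => // _.
by rewrite lee_fin mulr_ge0.
Qed.

Lemma opnorm_le A (K : R) :
  (forall x, \esum_(y in [set: X]) (`|A x y| * w y)%:E <= (K * w x)%:E)%E ->
  (opnorm w A <= K%:E)%E.
Proof.
move=> AK; apply: ge_ereal_sup => _ [c [cfin [x0 cx0]] <-].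
have nfin := wnorm_finite_support cfin; have npos := wnorm_gt0 cx0.
have K0 : 0 <= K.
  rewrite -(pmulr_lge0 _ (w_gt0 x0)) -lee_fin; apply: le_trans (AK x0).
  by apply: esum_ge0 => y _; rewrite lee_fin mulr_ge0.
have : (wnorm w (vecmul c A) <= K%:E * wnorm w c)%E.
  apply: le_trans (wnorm_vecmul_le c A) _.
  rewrite -esumZl//; last by move=> x; rewrite lee_fin mulr_ge0.
  apply: le_esum => x _; apply: le_trans (lee_wpmul2l _ (AK x)) _.
    by rewrite lee_fin.
  by rewrite -!EFinM lee_fin mulrCA.
have -> : wnorm w c = (fine (wnorm w c))%:E.
  by rewrite fineK// ge0_fin_numE// wnorm_ge0.
have fpos : 0 < fine (wnorm w c) by rewrite fine_gt0// npos.
by rewrite inver gt_eqF// lee_pdivrMr.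
Qed.

Definition point_mass x : X -> R := fun y => (y == x)%:R.

Lemma wnorm_point_mass x : wnorm w (point_mass x) = (w x)%:E.
Proof.
rewrite /wnorm /point_mass (esum_single x).
- by rewrite eqxx normr1 mul1r.
- by rewrite lee_fin mulr_ge0.
- by move=> y /negPf ->; rewrite normr0 mul0r.
Qed.

Lemma point_mass_test x :
  finite_set [set y | point_mass x y != 0] /\ exists y, point_mass x y != 0.
Proof.
split; last by exists x; rewrite /point_mass eqxx oner_eq0.
apply: (@sub_finite_set _ _ [set x]) => // y/=; rewrite /point_mass.
by have [//|_] := eqVneq y x; rewrite mulr0n eqxx.
Qed.

Lemma opnorm_ge0 A x : (0 <= opnorm w A)%E.
Proof.
apply: (@le_trans _ _ (wnorm w (vecmul (point_mass x) A) /
    wnorm w (point_mass x))%E).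
  rewrite wnorm_point_mass mule_ge0 ?wnorm_ge0// inver gt_eqF//.
  by rewrite lee_fin invr_ge0.
by apply: ereal_sup_ubound; exists (point_mass x) => //; exact: point_mass_test.
Qed.

(** Test the operator norm on the point mass at [x]. *)
Lemma act_le_opnorm A x : substochastic w A ->
  ((act A w x / w x)%:E <= opnorm w A)%E.
Proof.
move=> sA; apply: ereal_sup_ubound.
exists (point_mass x); first exact: point_mass_test.
have m0 y : 0 <= point_mass x y by rewrite ler0n.
rewrite wnorm_vecmul ?wnorm_point_mass ?ltry// (esum_single x).
- by rewrite /point_mass eqxx mul1r inver gt_eqF.
- rewrite lee_fin mulr_ge0//.
  exact: dominated_ge0 (act_dominated w_gt0 sA (dominated_w w_gt0)).
- by move=> y; rewrite /point_mass => /negPf ->; rewrite mul0r.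
Qed.

End Norms.

(** * Convergence to zero of nonnegative extended reals *)

Lemma cvge0_of_eventually_le {R : realType} (u : nat -> \bar R) :
  (forall n, 0 <= u n)%E ->
  (forall e : R, 0 < e -> exists N, forall n, (N <= n)%N -> (u n <= e%:E)%E) ->
  u n @[n --> \oo] --> 0%E.
Proof.
move=> u0 small; apply/fine_cvgP; split.
  have [N uN] := small 1 ltr01; exists N => // n /= Nn.
  by rewrite ge0_fin_numE// (le_lt_trans (uN n Nn))// ltry.
apply/cvgrPdist_le => e e0; have [N uN] := small e e0; exists N => // n /= Nn.
have un := uN n Nn; rewrite sub0r normrN ger0_norm ?fine_ge0//.
rewrite -lee_fin fineK// ge0_fin_numE//.
by rewrite (le_lt_trans un)// ltry.
Qed.

Lemma exists_le_of_cvge0 {R : realType} (u : nat -> \bar R) (e : R) :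
  u n @[n --> \oo] --> 0%E -> 0 < e -> exists n, (u n <= e%:E)%E.
Proof.
move=> /fine_cvgP[[N1 _ fin] /cvgrPdist_le cv] e0.
have [N2 _ le_e] := cv e e0.
exists (maxn N1 N2).
have fu := fin _ (leq_maxl N1 N2); have := le_e _ (leq_maxr N1 N2).
rewrite /= sub0r normrN -(fineK fu) lee_fin; apply: le_trans.
exact: ler_norm.
Qed.

(** * Convergence of cleaning to balayage *)

Section CleaningConvergence.
Context {R : realType} {X : countType}.
Set Implicit Arguments.
Unset Strict Implicit.
Variables (alpha : X -> X -> R) (w : X -> R) (Lambda : set X).
Variable h : nat -> X -> R.
Hypothesis alpha_ge0 : forall x y, 0 <= alpha x y.
Hypothesis w_gt0 : forall x, 0 < w x.
Hypothesis alpha_w : subinvariant alpha w.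
Hypothesis h_Lambda : forall i x, (1 <= i)%N -> 0 <= h i x <= \1_Lambda x.

Let g i := h i.+1.
Let g_range i x : 0 <= g i x <= \1_Lambda x.
Proof. exact: h_Lambda. Qed.
Let sclean i : substochastic w (cleaning alpha (g i)) :=
  substochastic_cleaning alpha_ge0 w_gt0 alpha_w (g01 g_range i).

Lemma substochastic_cleaning_prod N :
  substochastic w (cleaning_prod alpha h N).
Proof.
elim: N => [|N IH] /=.
  exact: (substochastic_matpow w_gt0 0%N (sclean 0%N)).
by apply: substochastic_matmul IH (sclean N).
Qed.

Lemma act_cleaning_prod N K v x : dominated w K v ->
  act (cleaning_prod alpha h N) v x = sweep alpha g (index_iota 0 N) v x.
Proof.
elim: N v => [|N IH] v dv.
  by rewrite act_diag ?mul1r// => y; exact: dominated_ge0 dv.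
rewrite [cleaning_prod _ _ _]/= (act_matmul w_gt0 x (substochastic_cleaning_prod N) (sclean N) dv).
rewrite (IH _ (act_dominated w_gt0 (sclean N) dv)).
by rewrite (@index_iota_cat 0 N N.+1) ?leqnSn// /sweep foldr_cat
  [in RHS]/index_iota subSnn.
Qed.

Lemma cleaning_prod_sub_balayage_le N x :
  (\esum_(y in [set: X])
     (`|matsub (cleaning_prod alpha h N) (balayage alpha Lambda) x y| * w y)%:E <=
   (2 * sweep alpha g (index_iota 0 N) (inner w Lambda) x)%:E)%E.
Proof.
have sPi := substochastic_balayage Lambda alpha_ge0 w_gt0 alpha_w.
rewrite -(act_cleaning_prod _ _ (inner_dominated Lambda w_gt0)).
apply: (sub_balayage_le alpha_ge0 w_gt0 alpha_w
  (substochastic_cleaning_prod N)) => y.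
rewrite (act_cleaning_prod _ _ (column_dominated w_gt0 y sPi)).
exact: sweep_balayage.
Qed.

Hypothesis h_diverges : forall M : R, exists N : nat,
  forall x, Lambda x -> M <= \sum_(1 <= i < N.+1) h i x.

Lemma cleaning_prod_error_le l (e : R) : 0 < e -> exists N0, forall N,
  (N0 <= N)%N -> forall x, (\esum_(y in [set: X])
     (`|matsub (cleaning_prod alpha h N) (balayage alpha Lambda) x y| * w y)%:E <=
   (2 * (act (matpow (restricted alpha Lambda) l) w x + e * w x))%:E)%E.
Proof.
move=> e0; have g_diverges (M : R) : exists N : nat, forall x,
    Lambda x -> M <= \sum_(0 <= i < N) g i x.
  have [N MN] := h_diverges M; exists N => x Lx.
  by have := MN x Lx; rewrite big_add1.
have [N0 HN0] := sweep_inner_le alpha_ge0 w_gt0 alpha_w g_range g_diverges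
  l 0 e0.
exists N0 => N N0N x; apply: le_trans (cleaning_prod_sub_balayage_le N x) _.
rewrite lee_fin ler_wpM2l//; apply: le_trans (HN0 N N0N x) _.
apply: lerD; first exact: inner_iter_le_act_matpow.
by rewrite ler_wpM2l ?(ltW e0)//; case/andP: (inner_le_w Lambda w_gt0 x).
Qed.

Lemma opnorm_cleaning_prod_cvg (x0 : X) :
  opnorm w (matpow (restricted alpha Lambda) l) @[l --> \oo] --> 0%E ->
  opnorm w (matsub (cleaning_prod alpha h N) (balayage alpha Lambda))
    @[N --> \oo] --> 0%E.
Proof.
move=> cvR; apply: cvge0_of_eventually_le => [N|e e0].
  exact: opnorm_ge0.
have e4 : 0 < e / 4 by lra.
have [l Rl] := exists_le_of_cvge0 cvR e4.
have [N0 HN0] := cleaning_prod_error_le l e4.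
exists N0 => N N0N; apply: opnorm_le => // x; apply: le_trans (HN0 N N0N x) _.
have sRl := substochastic_matpow w_gt0 l
  (substochastic_restricted Lambda alpha_ge0 w_gt0 alpha_w).
have := le_trans (act_le_opnorm w_gt0 x sRl) Rl.
rewrite !lee_fin ler_pdivrMr//; set r := act _ w x; have := w_gt0 x.
move: (w x) => t t0 rt; lra.
Qed.

Lemma wnorm_cleaning_prod_cvg (c : X -> R) :
  (forall x, 0 <= c x) -> (wnorm w c < +oo)%E ->
  wnorm w (vecmul c (matpow (restricted alpha Lambda) l)) @[l --> \oo] --> 0%E ->
  wnorm w (vecmul c (matsub (cleaning_prod alpha h N) (balayage alpha Lambda)))
    @[N --> \oo] --> 0%E.
Proof.
move=> c0 cfin cvR; apply: cvge0_of_eventually_le => [N|e e0].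
  exact: wnorm_ge0.
have w0 x := ltW (w_gt0 x).
pose C := fine (wnorm w c).
have C0 : 0 <= C by exact: fine_ge0 (wnorm_ge0 w_gt0 c).
have CE : (\esum_(x in [set: X]) (c x * w x)%:E)%E = C%:E.
  rewrite fineK ?ge0_fin_numE ?wnorm_ge0//.
  by apply: eq_esum => x _; rewrite ger0_norm.
(* [C + 1] rather than [C], because [c] may vanish. *)
pose d := e / (4 * (C + 1)).
have d0 : 0 < d by rewrite divr_gt0// mulr_gt0//; lra.
have e4 : 0 < e / 4 by lra.
have dC : d * C <= e / 4.
  rewrite /d invfM mulrA -[leRHS]mulr1 -mulrA ler_wpM2l ?(ltW e4)//.
  by rewrite mulrC ler_pdivrMr; lra.
have [l Rl] := exists_le_of_cvge0 cvR e4.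
have [N0 HN0] := cleaning_prod_error_le l d0.
have sRl := substochastic_matpow w_gt0 l
  (substochastic_restricted Lambda alpha_ge0 w_gt0 alpha_w).
have act0 x : 0 <= act (matpow (restricted alpha Lambda) l) w x.
  by apply: usum_ge0 => y; rewrite mulr_ge0//; case: sRl.
exists N0 => N N0N; apply: le_trans (wnorm_vecmul_le w_gt0 c _) _.
apply: (@le_trans _ _ (\esum_(x in [set: X])
   (2%:E * ((c x * act (matpow (restricted alpha Lambda) l) w x)%:E +
     d%:E * (c x * w x)%:E)))%E).
  apply: le_esum => x _; rewrite ger0_norm//.
  apply: le_trans (lee_wpmul2l _ (HN0 N N0N x)) _; first by rewrite lee_fin.
  by rewrite -(EFinM d) -EFinD -!EFinM lee_fin le_eqVlt; apply/orP; left;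
    apply/eqP; ring.
rewrite esumZl//; last first.
  move=> x; rewrite -EFinM -EFinD lee_fin addr_ge0// mulr_ge0//.
    exact: ltW.
  exact: mulr_ge0.
rewrite esumD; last 2 first.
- by move=> x _; rewrite lee_fin mulr_ge0.
- by move=> x _; rewrite -EFinM lee_fin mulr_ge0 ?(ltW d0)// mulr_ge0.
rewrite esumZl ?(ltW d0)//; last by move=> x; rewrite lee_fin mulr_ge0.
rewrite CE -(wnorm_vecmul w_gt0 c0 cfin sRl).
apply: (@le_trans _ _ (2%:E * ((e / 4)%:E + (e / 4)%:E))%E).
  by rewrite lee_wpmul2l// ?lee_fin// leeD// -EFinM lee_fin.
by rewrite -EFinD -EFinM lee_fin; lra.
Qed.

End CleaningConvergence.

Theorem theorem3p19 (R : realType) (X : countType) (X_nonempty : [set: X] !=set0)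
    (alpha : X -> X -> R) (alpha_ge0 : forall x y, 0 <= alpha x y)
    (w : X -> R) (w_gt0 : forall x, 0 < w x)
    (alpha_w : subinvariant alpha w)
    (Lambda : set X) (h : nat -> X -> R)
    (h_range : forall i x, (1 <= i)%N -> 0 <= h i x <= 1)
    (h_Lambda : forall i x, (1 <= i)%N -> 0 <= h i x <= \1_Lambda x)
    (h_diverges : forall M : R, exists N : nat,
       forall x, Lambda x -> M <= \sum_(1 <= i < N.+1) h i x) :
  (opnorm w (matpow (restricted alpha Lambda) l) @[l --> \oo] --> 0%E ->
   opnorm w (matsub (cleaning_prod alpha h N) (balayage alpha Lambda))
     @[N --> \oo] --> 0%E)
  /\
  (forall c : X -> R, (forall x, 0 <= c x) -> (wnorm w c < +oo)%E ->
   wnorm w (vecmul c (matpow (restricted alpha Lambda) l)) @[l --> \oo] --> 0%E ->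
   wnorm w (vecmul c (matsub (cleaning_prod alpha h N) (balayage alpha Lambda)))
     @[N --> \oo] --> 0%E).
Proof.
have [x0 _] := X_nonempty.
split; first exact: (opnorm_cleaning_prod_cvg alpha_ge0 w_gt0 alpha_w h_Lambda
  h_diverges x0).
by move=> c; exact: wnorm_cleaning_prod_cvg.
Qed.
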